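(* Let $X$ be a Baire space, $Y$ a topological space, $(Z,d)$ a metric space, and $f:X\times Y\to Z$ a mapping. Suppose that for each $y\in Y$, $\pi_\chi(y,Y)\leq\aleph_0$ and $f^y$ is quasicontinuous, and that $f_x$ is fragmentable for each $x\in X$. Then $f$ is cliquish.
   Context: No separation axioms are assumed on topological spaces. Sections: for $f:X\times Y\to Z$, put $f_x:Y\to Z$, $f_x(y)=f(x,y)$, and $f^y:X\to Z$, $f^y(x)=f(x,y)$. A mapping $g:T\to Z$ from a topological space $T$ to a metric space $(Z,d)$ is cliquish if for any $\varepsilon>0$ and any nonempty open $U\subset T$ there is a nonempty open $O\subset U$ with $d(g(s),g(t))<\varepsilon$ for all $s,t\in O$. It is fragmentable if the restriction of $g$ to each nonempty subspace of $T$ is cliquish. It is quasicontinuous if for every $\varepsilon>0$, every $t\in T$ and every neighborhood $V$ of $t$ there is a nonempty open set $O\subset V$ with $d(g(t),g(s))<\varepsilon$ for each $s\in O$. A network at $y$ in $Y$ is a collection $\mathcal N$ of subsets of $Y$ such that every neighborhood of $y$ in $Y$ contains some nonempty member of $\mathcal N$. A $\pi$-base at $y$ in $Y$ is a network at $y$ all of whose members are open. $\pi_\chi(y,Y)\leq\aleph_0$ means that $y$ has a countable $\pi$-base in $Y$. *)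

(* Defs.v *)
From mathcomp Require Import all_boot all_order all_algebra.
From mathcomp Require Import all_classical all_reals topology.

Set Implicit Arguments.
Unset Strict Implicit.
Unset Printing Implicit Defensive.

Import Order.TTheory GRing.Theory Num.Theory.
Local Open Scope classical_set_scope.
Local Open Scope ring_scope.

Definition baire_space (X : topologicalType) : Prop :=
  forall U : nat -> set X,
    (forall n, open (U n) /\ dense (U n)) -> dense (\bigcap_n U n).

Definition cliquish (R : realType) (T : topologicalType) (Z : metricType R)
    (g : T -> Z) : Prop :=
  forall (e : R) (U : set T), 0 < e -> open U -> U !=set0 ->
    exists O : set T, [/\ open O, O !=set0, O `<=` U &
      forall s t, O s -> O t -> mdist (g s) (g t) < e].

(* [set_type A] is the subtype of points of [A], with the induced topology. *)
Definition fragmentable (R : realType) (T : topologicalType) (Z : metricType R)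
    (g : T -> Z) : Prop :=
  forall A : set T, A !=set0 -> cliquish (fun a : set_type A => g (set_val a)).

Definition quasicontinuous (R : realType) (T : topologicalType)
    (Z : metricType R) (g : T -> Z) : Prop :=
  forall (e : R) (t : T) (V : set T), 0 < e -> nbhs t V ->
    exists O : set T, [/\ open O, O !=set0, O `<=` V &
      forall s, O s -> mdist (g t) (g s) < e].

Definition network_at (Y : topologicalType) (y : Y) (N : set (set Y)) : Prop :=
  forall V : set Y, nbhs y V -> exists B, [/\ N B, B !=set0 & B `<=` V].

Definition pi_base_at (Y : topologicalType) (y : Y) (N : set (set Y)) : Prop :=
  network_at y N /\ (forall B, N B -> open B).

Definition countable_pi_character (Y : topologicalType) (y : Y) : Prop :=
  exists N : set (set Y), countable N /\ pi_base_at y N.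

(* Main.v *)
Require Import Defs.
From mathcomp Require Import all_boot all_order all_algebra.
From mathcomp Require Import all_classical all_reals topology.
From mathcomp Require Import lra zify.
From Stdlib Require Cantor.

Set Implicit Arguments.
Unset Strict Implicit.
Unset Printing Implicit Defensive.

Import Order.TTheory GRing.Theory Num.Theory.
Local Open Scope classical_set_scope.
Local Open Scope ring_scope.

(** Suppose that [f] oscillates by at least [e] on every nonempty open subset
    of some open box [U `*` V].  The contradiction comes from a single point
    [x] of [U] and a sequence [a] in [V], chosen together, such that the section
    of [f] at [x] oscillates by at least [e / 4] on every nonempty relatively
    open subset of [range a]; this section is then not fragmentable.

    A relatively open set containing [a i] contains the trace on [range a] of
    some nonempty member [C] of a countable pi-base at [a i], with [C] inside [V].  Hence
    it suffices that, for each [i] and each such [C], some later term [a n] lies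
    in [C] and has [f (x, a n)] at distance at least [e / 4] from [f (x, a i)].
    There are countably many such requirements, and each one can be met on an
    open set of parameters: by quasicontinuity of the sections in the first
    variable, any nonempty open [O `<=` U] contains a nonempty open [O'] on which
    one and the same [b] in [C] works for every [x] ([quasicontinuous_far]).

    The choice of [b] depends on [O], so no fixed sequence serves all [x].
    Instead the sequence is grown along a tree of open sets: at level [n] there
    is a disjoint family of open sets with dense union in [U], each carrying the
    first [n] terms ([tiling_refine]).  Since [X] is Baire, some [x] lies in the
    union of every level, and by disjointness the sets containing it form a
    branch, which reads off the sequence ([baire_play]).  This is the argument of
    Oxtoby on the Banach-Mazur game. *)

(** Disjointness is imposed on the pairs, so that a point of [U] lying in a tile
    determines the history attached to it. *)
Definition tiling (X : topologicalType) (A : Type) (U : set X)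
    (F : set (set X * seq A)) : Prop :=
  [/\ trivIset F fst, forall p, F p -> open p.1 /\ p.1 `<=` U &
      forall W, open W -> W !=set0 -> W `<=` U ->
        exists p, F p /\ W `&` p.1 !=set0].

(** The children of a tile are the open subsets on which one answer [a] is
    valid.  A maximal disjoint family of children still has dense union: where it
    missed an open set, the hypothesis would provide one more child. *)
Lemma tiling_refine (X : topologicalType) (A : Type) (U : set X)
    (R : seq A -> X -> A -> Prop) (F : set (set X * seq A)) :
  (forall h O, open O -> O !=set0 -> O `<=` U ->
    exists O' a, [/\ open O', O' !=set0, O' `<=` O & forall x, O' x -> R h x a]) ->
  tiling U F ->
  exists G, tiling U G /\
    forall q, G q -> exists p a,
      [/\ F p, q.1 `<=` p.1, q.2 = rcons p.2 a & forall x, q.1 x -> R p.2 x a].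
Proof.
move=> move_ [Ftriv Fopen Fdense].
pose child (q : set X * seq A) := open q.1 /\ exists p a,
  [/\ F p, q.1 `<=` p.1, q.2 = rcons p.2 a & forall x, q.1 x -> R p.2 x a].
have [G [Gchild Gtriv Gmax]] := ex_maximal_disjoint_subcollection fst child.
exists G; split; last by move=> q /Gchild[].
split => //.
  move=> q /Gchild[oq [p [a [Fp qp _ _]]]]; split=> //.
  by apply: subset_trans qp _; case: (Fopen _ Fp).
move=> W oW W0 WU; have [p [Fp Wp]] := Fdense W oW W0 WU.
have [op pU] := Fopen p Fp.
have [O [a [oO O0 OWp Ra]]] :
    exists O a, [/\ open O, O !=set0, O `<=` W `&` p.1 &
      forall x, O x -> R p.2 x a].
  by apply: move_ => //; [exact: openI | move=> x [_ /pU]].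
pose q := (O, rcons p.2 a).
have childq : child q.
  by split=> //; exists p, a; split=> // x /OWp[].
apply: contrapT => noq.
have farq r : G r -> ~ (O `&` r.1 !=set0).
  move=> Gr [x [Ox rx]]; apply: noq; exists r; split=> //.
  by exists x; split=> //; case: (OWp x Ox).
have Gq : ~ G q by move=> /farq; apply; case: O0 => x Ox; exists x.
apply: (Gmax (G `|` [set q])).
- split; first exact: subsetUl.
  by move=> sub; apply: Gq; apply: sub; right.
- by move=> r [/Gchild //|->].
- move=> r s [Gr|->] [Gs|->] //.
  + exact: Gtriv.
  + by rewrite setIC => /(farq _ Gr).
  + by move=> /(farq _ Gs).
Qed.

(** In a Baire space, answers that can be made locally constant somewhere inside
    every open set can be made infinitely often in succession, each depending on
    the previous ones, at one common point. *)
Lemma baire_play (X : topologicalType) (A : Type) (U : set X)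
    (R : seq A -> X -> A -> Prop) :
  baire_space X -> open U -> U !=set0 ->
  (forall h O, open O -> O !=set0 -> O `<=` U ->
    exists O' a, [/\ open O', O' !=set0, O' `<=` O & forall x, O' x -> R h x a]) ->
  exists x (a : nat -> A), U x /\ forall n, R (mkseq a n) x (a n).
Proof.
move=> hX oU U0 move_.
have /boolp.choice[next nextP] : forall F : set (set X * seq A), exists G,
    tiling U F -> tiling U G /\ forall q, G q -> exists p a,
      [/\ F p, q.1 `<=` p.1, q.2 = rcons p.2 a & forall x, q.1 x -> R p.2 x a].
  move=> F; have [tF|ntF] := pselect (tiling U F); last by exists F.
  by have [G GP] := tiling_refine move_ tF; exists G.
pose F n := iter n next [set (U, [::])].
have tF n : tiling U (F n).
  elim: n => [|n /nextP[]//]; split=> [p q -> ->//|p ->|W oW [x Wx] WU].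
    by split.
  by exists (U, [::]); split=> //; exists x; split=> //; exact: WU.
(* The complement of the closure makes these sets dense in the whole space, as
   the Baire property requires; it is disjoint from U. *)
pose D n := \bigcup_(p in F n) p.1 `|` ~` closure U.
have [n|x [Ux Dx]] := hX D _ U U0 oU.
  have [_ Fopen Fdense] := tF n; split.
    apply: openU; last exact/closed_openC/closed_closure.
    by apply: bigcup_open => p /Fopen[].
  move=> W [x Wx] oW; have [UW|nUW] := pselect (W `&` U !=set0).
    have [p [Fp [z [[Wz _] pz]]]] := Fdense _ (openI oW oU) UW (@subIsetr _ W U).
    by exists z; split=> //; left; exists p.
  exists x; split=> //; right => clUx; apply: nUW.
  by have [z []] := clUx W (open_nbhs_nbhs (conj oW Wx)); exists z.
have /boolp.choice[p pP] : forall n, exists p, F n p /\ p.1 x.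
  move=> n; have [[p Fp px]|/(_ (subset_closure Ux))//] := Dx n I.
  by exists p.
have /boolp.choice[a aP] : forall n, exists a, (p n.+1).2 = rcons (p n).2 a /\ R (p n).2 x a.
  move=> n; have [Fp px] := pP n.+1.
  have [q [a [Fq pq eqa Ra]]] := (nextP _ (tF n)).2 _ Fp.
  have [Ftriv _ _] := tF n; have [Fpn pnx] := pP n.
  (* The parent of the tile chosen at level n+1 contains x, hence is the tile
     chosen at level n. *)
  have eq_qp : q = p n by apply: Ftriv => //; exists x; split=> //; exact: pq.
  by exists a; rewrite -eq_qp; split=> //; exact: Ra.
have hist n : (p n).2 = mkseq a n.
  elim: n => [|n IHn]; first by have [->] := pP 0%N.
  by rewrite mkseqS -IHn; case: (aP n).
by exists x, a; split=> // n; rewrite -hist; case: (aP n).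
Qed.

Lemma countable_pi_character_enum (Y : topologicalType) (y : Y) :
  countable_pi_character y ->
  exists B : nat -> set Y, (forall j, open (B j)) /\
    forall V, nbhs y V -> exists j, B j !=set0 /\ B j `<=` V.
Proof.
move=> [N [/countable_injP[i iinj] [Nnet Nopen]]].
(* An injection of N into nat is inverted; indices outside its image receive the
   empty set, which is open and harmless since only nonempty members count. *)
pose P n := [set C | N C /\ i C = n].
exists (fun n => xget set0 (P n)); split=> [n|V /Nnet[C [NC C0 CV]]].
  by case: xgetP => [C _ [/Nopen]//|_]; exact: open0.
exists (i C); rewrite (_ : xget _ _ = C)//; apply: xget_unique => //.
by move=> C' [NC' /iinj]; rewrite !inE; exact.
Qed.

(** First the section at [y] is made nearly constant on [O1].  As [f] still
    oscillates by [e] on [O1 `*` B], one of two witnesses has a value [e / 2] away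
    from that constant; quasicontinuity of the section through this witness keeps
    its value nearly unchanged on a smaller open set, and only [e / 8] is lost
    on either side. *)
Lemma quasicontinuous_far (R : realType) (X Y : topologicalType) (Z : metricType R)
    (f : X * Y -> Z) (e : R) (O : set X) (B : set Y) (y : Y) :
  (forall y : Y, quasicontinuous (fun x : X => f (x, y))) -> 0 < e ->
  open O -> O !=set0 -> open B -> B !=set0 ->
  (forall O' : set X, open O' -> O' !=set0 -> O' `<=` O ->
    exists s t, [/\ (O' `*` B) s, (O' `*` B) t & e <= mdist (f s) (f t)]) ->
  exists O' b, [/\ open O', O' !=set0, O' `<=` O, B b &
    forall x, O' x -> e / 4 <= mdist (f (x, y)) (f (x, b))].
Proof.
move=> hfy e0 oO [x0 Ox0] oB B0 osc.
have e8 : 0 < e / 8 by rewrite divr_gt0.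
have [O1 [oO1 O10 O1O O1e]] := hfy y _ _ _ e8 (open_nbhs_nbhs (conj oO Ox0)).
have [x1 [b [O1x1 Bb far]]] : exists x1 b,
    [/\ O1 x1, B b & e / 2 <= mdist (f (x0, y)) (f (x1, b))].
  have [s [t [[Os Bs] [Ot Bt] est]]] := osc _ oO1 O10 O1O.
  have := le_trans est (metric_triangle _ (f (x0, y)) _).
  rewrite metric_sym => tri.
  have [fs|fs] := leP (e / 2) (mdist (f (x0, y)) (f s)).
    by exists s.1, s.2; split=> //; rewrite -surjective_pairing.
  exists t.1, t.2; split=> //; rewrite -surjective_pairing.
  lra.
have [O2 [oO2 O20 O2O1 O2e]] := hfy b _ _ _ e8 (open_nbhs_nbhs (conj oO1 O1x1)).
exists O2, b; split=> //; first exact: subset_trans O1O.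
move=> x O2x; have := O2e x O2x; have := O1e x (O2O1 x O2x).
have := metric_triangle (f (x0, y)) (f (x, y)) (f (x1, b)).
have := metric_triangle (f (x, y)) (f (x, b)) (f (x1, b)).
rewrite (metric_sym (f (x, b)) (f (x1, b))).
lra.
Qed.

(** Fragmentability applied to the subspace [range a], read back in terms of
    indices and open sets of [Y]. *)
Lemma fragmentable_range (R : realType) (Y : topologicalType) (Z : metricType R)
    (g : Y -> Z) (a : nat -> Y) (e : R) : 0 < e -> fragmentable g ->
  exists n W, [/\ open W, W (a n) &
    forall m, W (a m) -> mdist (g (a n)) (g (a m)) < e].
Proof.
move=> e0 frag; have D0 : range a !=set0 by exists (a 0%N), 0%N.
have setT0 : [set: set_type (range a)] !=set0.
  by exists (SigSub (mem_set (imageT a 0%N))).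
have [O [[W oW <-] [d Wd] _ Oe]] := frag _ D0 e setT e0 openT setT0.
have /set_mem[n _ adn] := valP d.
exists n, W; split=> //; first by rewrite adn.
move=> m Wm; rewrite adn.
exact: (Oe d (SigSub (mem_set (imageT a m)))).
Qed.

Theorem corollary3p5 (R : realType) (X Y : topologicalType) (Z : metricType R)
    (f : X * Y -> Z)
    (hX : baire_space X)
    (hY : forall y : Y, countable_pi_character y)
    (hfy : forall y : Y, quasicontinuous (fun x : X => f (x, y)))
    (hfx : forall x : X, fragmentable (fun y : Y => f (x, y))) :
  cliquish f.
Proof.
move=> e W e0 oW [[x0 y0] Wxy0]; apply: contrapT => nosmall.
have osc O : open O -> O !=set0 -> O `<=` W ->
    exists s t, [/\ O s, O t & e <= mdist (f s) (f t)].
  move=> oO O0 OW; apply: contrapT => small; apply: nosmall; exists O; split=> //.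
  move=> s t Os Ot; rewrite ltNge; apply/negP => est.
  by apply: small; exists s, t.
have [U [V [oU Ux0 oV Vy0 UVW]]] : exists U V,
    [/\ open U, U x0, open V, V y0 & U `*` V `<=` W].
  have [[P Q]/= [nP nQ] PQW] := open_nbhs_nbhs (conj oW Wxy0).
  exists P°, Q°; split; [exact: open_interior|exact: nP|exact: open_interior|exact: nQ|].
  by move=> [u v] [/= /interior_subset Pu /interior_subset Qv]; exact: PQW.
have /boolp.choice[B BP] y := countable_pi_character_enum (hY y).
(* The term a (n+1) serves the pair (i, j) with code n: it must lie in the
   j-th member of the pi-base at a i.  The pairing satisfies i <= n, so a i is
   already in the history.  When the pi-base member misses V, any point of V is a
   legal answer. *)
pose task (h : seq Y) := Cantor.of_nat (size h).-1.
pose y h := nth y0 h (task h).1.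
pose C h := B (y h) (task h).2 `&` V.
pose move_ h x b := V b /\
  (C h !=set0 -> C h b /\ e / 4 <= mdist (f (x, y h)) (f (x, b))).
have [|h O oO O0 OU|x [a [_ aP]]] := baire_play (R := move_) hX oU; first by exists x0.
  have [C0|nC0] := pselect (C h !=set0); last first.
    by exists O, y0; split=> // x _; split=> // /nC0.
  have oC : open (C h) by apply: openI => //; exact: (BP _).1.
  have [|O' [b [oO' O'0 O'O Cb far]]] :=
    quasicontinuous_far (y h) hfy e0 oO O0 oC C0.
    move=> O' oO' [x O'x] O'O; case: C0 => b Cb; apply: osc.
    - rewrite openE => -[u v] [/= O'u Cv]; exists (O', C h) => //.
      by split; apply: open_nbhs_nbhs.
    - by exists (x, b).
    - by move=> [u v] [/= /O'O /OU Uu [_ Vv]]; exact: UVW.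
  by exists O', b; split=> // x /far; split=> //; case: Cb.
have e4 : 0 < e / 4 by rewrite divr_gt0.
have [i [T [oT Tai close]]] := fragmentable_range a e4 (hfx x).
have nTV : nbhs (a i) (T `&` V).
  by apply: open_nbhs_nbhs; split; [exact: openI|split=> //; case: (aP i)].
have [j [[b Bb] BTV]] := (BP (a i)).2 _ nTV.
pose n := Cantor.to_nat (i, j).
have taskn : task (mkseq a n.+1) = (i, j).
  by rewrite /task size_mkseq Cantor.cancel_of_to.
have lein : (i < n.+1)%N.
  by have := Cantor.to_nat_non_decreasing i j; lia.
have yn : y (mkseq a n.+1) = a i by rewrite /y taskn nth_mkseq.
have [_] := aP n.+1; rewrite /C yn taskn /=; case.
  by exists b; split=> //; case: (BTV b Bb).
move=> [Ban _]; rewrite leNgt => /negP; apply; apply: close.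
by case: (BTV _ Ban).
Qed.
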